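(* Let $\mathbf{x}=(x_1,x_2,\dots)$ and $\mathbf{y}=(y_1,y_2,\dots)$ be elements of $\ell^1(\mathbb{Z}_3)$. If $$\sum_{j\ge1}\frac{(\mathbf{x}+\mathbf{y})_j}{j+1}=\sum_{j\ge1}\frac{x_j}{j+1}+\sum_{j\ge1}\frac{y_j}{j+1}$$ and $\mathbf{z}(\mathbf{x},\mathbf{y})=0$, then the point $(a,b)$ with $a=\sum_{j\ge1}x_j3^{-j}$ and $b=\sum_{j\ge1}y_j3^{-j}$ (i.e. $a=[0.x_1x_2\dots]_3$, $b=[0.y_1y_2\dots]_3$ in balanced ternary) lies in the hexagon snowflake fractal $S_F$.
   Context: $\ell^1(\mathbb{Z}_3)$ is the set of sequences with entries in $\{-1,0,1\}$ having only finitely many nonzero entries, with addition componentwise modulo $3$ using representatives $\{-1,0,1\}$. The vector $\mathbf{z}(\mathbf{x},\mathbf{y})$ has $j$-th component $1$ if $x_j=y_j=1$, $-1$ if $x_j=y_j=-1$, $0$ otherwise. The hexagon snowflake fractal: let $H_0$ be the hexagon with vertices $(\tfrac12,0),(0,\tfrac12),(-\tfrac12,\tfrac12),(-\tfrac12,0),(0,-\tfrac12),(\tfrac12,-\tfrac12)$, i.e. $\{(x,y)\in[-\tfrac12,\tfrac12]^2:-\tfrac12\le x+y\le\tfrac12\}$, from which the two triangles with vertices $(\tfrac13,\tfrac16),(\tfrac16,\tfrac16),(\tfrac16,\tfrac13)$ and $(-\tfrac13,-\tfrac16),(-\tfrac16,-\tfrac16),(-\tfrac16,-\tfrac13)$ are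 removed, namely the points with $x>\tfrac16,y>\tfrac16$ and those with $x<-\tfrac16,y<-\tfrac16$. Let $v_0=(0,0)$, $v_1=(\tfrac13,0)$, $v_2=(0,\tfrac13)$, $v_3=(\tfrac13,-\tfrac13)$, $v_4=-v_1$, $v_5=-v_2$, $v_6=-v_3$. Set $G_0=H_0$ and $G_{j}=\bigcup_{i=0}^6\big(\tfrac13G_{j-1}+v_i\big)$ for $j\ge1$; $S_F=\bigcap_{n\ge0}G_n$. *)

(* Defs.v *)
From HB Require Import structures.
From mathcomp Require Import all_boot all_order all_algebra.
From mathcomp Require Import all_classical all_reals all_analysis.
From mathcomp Require Import zify.

Set Implicit Arguments.
Unset Strict Implicit.
Unset Printing Implicit Defensive.

Import Order.TTheory GRing.Theory Num.Theory.

Local Open Scope classical_set_scope.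
Local Open Scope ring_scope.

(* Sequences are indexed from 0: [x k] is the component x_{k+1} of the
   mathematical sequence (x_1, x_2, ...). *)
Record l1Z3 := L1Z3 {
  l1_seq :> nat -> int;
  l1_digit : forall k, l1_seq k \in [:: -1; 0; 1];
  l1_finite : finite_set [set k | l1_seq k != 0] }.

Lemma l1Z3_ext (x y : l1Z3) : (forall k, x k = y k) -> x = y.
Proof.
case: x y => [x dx fx] [y dy fy] /= /funext exy; subst y.
by congr L1Z3; exact: Prop_irrelevance.
Qed.

HB.instance Definition _ := gen_eqMixin l1Z3.
HB.instance Definition _ := gen_choiceMixin l1Z3.

(* The representative of m modulo 3 in {-1, 0, 1}. *)
Definition bal3 (m : int) : int := ((m + 1) %% 3)%Z - 1.

Lemma bal3_digit m : bal3 m \in [:: -1; 0; 1].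
Proof. by rewrite !inE /bal3; lia. Qed.

Lemma bal3_finite (x y : l1Z3) :
  finite_set [set k | bal3 (x k + y k) != 0].
Proof.
have := l1_finite y; have := l1_finite x => fx fy.
apply: (@sub_finite_set _ _
  ([set k | x k != 0] `|` [set k | y k != 0])); last by rewrite finite_setU.
move=> k /=; case: (eqVneq (x k) 0) => [->|]; last by left.
by case: (eqVneq (y k) 0) => [->|]; [rewrite addr0|right].
Qed.

Definition l1_add (x y : l1Z3) : l1Z3 :=
  @L1Z3 (fun k => bal3 (x k + y k)) (fun k => bal3_digit _) (bal3_finite x y).

Lemma zero_finite : finite_set [set k : nat | (0 : int) != 0].
Proof.
by apply: sub_finite_set (finite_set0 nat).
Qed.

Definition l1_zero : l1Z3 :=
  @L1Z3 (fun=> 0) (fun=> isT) zero_finite.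

Lemma opp_digit (x : l1Z3) k : - x k \in [:: -1; 0; 1].
Proof. by have := l1_digit x k; rewrite !inE; lia. Qed.

Lemma opp_finite (x : l1Z3) : finite_set [set k | - x k != 0].
Proof.
by apply: sub_finite_set (l1_finite x) => k /=; rewrite oppr_eq0.
Qed.

Definition l1_opp (x : l1Z3) : l1Z3 :=
  @L1Z3 (fun k => - x k) (opp_digit x) (opp_finite x).

Lemma l1_addA : associative l1_add.
Proof. by move=> x y w; apply: l1Z3_ext => k /=; rewrite /bal3; lia. Qed.

Lemma l1_addC : commutative l1_add.
Proof. by move=> x y; apply: l1Z3_ext => k /=; rewrite addrC. Qed.

Lemma l1_add0 : left_id l1_zero l1_add.
Proof.
move=> x; apply: l1Z3_ext => k /=.
by have := l1_digit x k; rewrite /bal3 !inE; lia.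
Qed.

Lemma l1_addN : left_inverse l1_zero l1_opp l1_add.
Proof. by move=> x; apply: l1Z3_ext => k /=; rewrite addNr. Qed.

HB.instance Definition _ :=
  GRing.isZmodule.Build l1Z3 l1_addA l1_addC l1_add0 l1_addN.

Definition common (a b : int) : int :=
  if (a == 1) && (b == 1) then 1
  else if (a == -1) && (b == -1) then -1 else 0.

Lemma common_digit a b : common a b \in [:: -1; 0; 1].
Proof. by rewrite /common; case: ifP => // _; case: ifP. Qed.

Lemma common_finite (x y : l1Z3) :
  finite_set [set k | common (x k) (y k) != 0].
Proof.
apply: sub_finite_set (l1_finite x) => k /=.
by case: (eqVneq (x k) 0) => [->|].
Qed.

Definition zvec (x y : l1Z3) : l1Z3 :=
  @L1Z3 (fun k => common (x k) (y k)) (fun k => common_digit _ _)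
    (common_finite x y).

Section Snowflake.
Variable R : realType.

Definition hexagon : set (R * R) :=
  [set p | [/\ - (1 / 2) <= p.1 <= 1 / 2, - (1 / 2) <= p.2 <= 1 / 2
             & - (1 / 2) <= p.1 + p.2 <= 1 / 2]].

(* Within the hexagon, the two removed sets are the two triangles without
   their sides on the lines x = 1/6, y = 1/6 (resp. x = -1/6, y = -1/6). *)
Definition notched : set (R * R) :=
  hexagon `\` ([set p | 1 / 6 < p.1 /\ 1 / 6 < p.2] `|`
               [set p | p.1 < - (1 / 6) /\ p.2 < - (1 / 6)]).

Definition snow_shift (i : 'I_7) : R * R :=
  let v1 := (1 / 3, 0) in let v2 := (0, 1 / 3) in
  let v3 := (1 / 3, - (1 / 3)) in
  nth 0 [:: (0, 0); v1; v2; v3; - v1; - v2; - v3] i.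

Fixpoint snow (n : nat) : set (R * R) :=
  if n is m.+1 then
    \bigcup_(i in [set: 'I_7])
      [set (p.1 / 3, p.2 / 3) + snow_shift i | p in snow m]
  else notched.

Definition snowflake : set (R * R) := \bigcap_(n in [set: nat]) snow n.

End Snowflake.

(* Main.v *)
(* The vanishing of z(x,y) leaves exactly seven possible digit pairs (x_j,y_j),
   and these are 3 v_0, ..., 3 v_6.  Splitting off the first digit therefore
   writes (a,b) as p/3 + v_i with p of the same kind, so that membership in
   every G_n reduces to membership in G_0.  The hexagon inequalities hold since
   x_j, y_j and x_j + y_j all lie in {-1,0,1}, and a > 1/6 forces x_1 = 1, so a
   point in a removed triangle would have x_1 = y_1 = 1 or x_1 = y_1 = -1. *)
Require Import Defs.
From mathcomp Require Import all_boot all_order all_algebra.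
From mathcomp Require Import all_classical all_reals all_analysis.
From mathcomp Require Import zify lra.

Import Order.TTheory GRing.Theory Num.Theory.
Import numFieldNormedType.Exports.

Local Open Scope classical_set_scope.
Local Open Scope ring_scope.

(** Truncated expansions keep limits out of the induction; [lim_bt_sum] restores them at the end. *)
Definition bt_sum (R : realType) (u : nat -> int) (N : nat) : R :=
  \sum_(k < N) (u k)%:~R / 3 ^+ k.+1.

Lemma bt_sumS (R : realType) (u : nat -> int) (N : nat) :
  bt_sum R u N.+1 = (u 0)%:~R / 3 + bt_sum R (fun k => u k.+1) N / 3.
Proof.
rewrite /bt_sum big_ord_recl expr1 mulr_suml; congr (_ + _).
by apply: eq_bigr => k _; rewrite -mulrA -invfM -exprSr.
Qed.

Lemma bt_sumD (R : realType) (u v : nat -> int) (N : nat) :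
  bt_sum R (fun k => u k + v k) N = bt_sum R u N + bt_sum R v N.
Proof.
by rewrite -big_split; apply: eq_bigr => k _ /=; rewrite intrD mulrDl.
Qed.

(** The bound reproduces itself: [1/3 + (1/2)/3 = 1/2]. *)
Lemma bt_sum_bound (R : realType) (u : nat -> int) (N : nat) :
  (forall k, u k \in [:: -1; 0; 1]) -> - (1 / 2) <= bt_sum R u N <= 1 / 2.
Proof.
elim: N u => [|N IH] u du; first by rewrite /bt_sum big_ord0; lra.
rewrite bt_sumS; have := IH _ (fun k => du k.+1).
by move: (du 0); rewrite !inE => /or3P[] /eqP ->; lra.
Qed.

(** The pairs follow the order of [snow_shift], scaled by 3, so a position in the list is the index
    of a copy. *)
Lemma common0 (a b : int) : common a b = 0 -> a \in [:: -1; 0; 1] ->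
  b \in [:: -1; 0; 1] ->
  (a, b) \in [:: (0, 0); (1, 0); (0, 1); (1, -1); (-1, 0); (0, -1); (-1, 1)].
Proof. move=> ab0 ad bd; move: ad bd ab0; rewrite !inE.
by move=> /or3P[] /eqP-> /or3P[] /eqP->. Qed.

Lemma snow_bt_sum (R : realType) (u v : nat -> int) (N n : nat) :
  (forall k, u k \in [:: -1; 0; 1]) -> (forall k, v k \in [:: -1; 0; 1]) ->
  (forall k, common (u k) (v k) = 0) ->
  (forall k, (N <= k)%N -> u k = 0 /\ v k = 0) ->
  snow n (bt_sum R u N, bt_sum R v N).
Proof.
elim: n u v => [|n IH] u v du dv cuv uv0.
(* The zero digit at [N] pads the tail by one term, so [N] stays fixed in the induction on [n]. *)
all: have bt_sum_recl (w : nat -> int) : w N = 0 ->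
  bt_sum R w N = (w 0)%:~R / 3 + bt_sum R (fun k => w k.+1) N / 3
  by move=> wN; rewrite -bt_sumS /bt_sum big_ord_recr /= wN mul0r addr0.
all: have [uN vN] := uv0 N (leqnn N).
all: have := common0 _ _ (cuv 0) (du 0) (dv 0).
(* No pair has two equal nonzero digits, so the sums are digits too; this bounds the sum of the
   coordinates. *)
- have dw k : u k + v k \in [:: -1; 0; 1].
    by have := common0 _ _ (cuv k) (du k) (dv k); rewrite !inE !xpair_eqE; lia.
  have bw := bt_sum_bound R _ N dw; rewrite bt_sumD in bw.
  have bu := bt_sum_bound R _ N du; have bv := bt_sum_bound R _ N dv.
  move=> d0; split; first by split.
  (* A tail contributes at most [(1/2)/3 = 1/6] in absolute value, so crossing a notch line takes a
     first digit of that sign. *)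
  have bu' := bt_sum_bound R _ N (fun k => du k.+1).
  have bv' := bt_sum_bound R _ N (fun k => dv k.+1).
  move=> /=; rewrite (bt_sum_recl u)// (bt_sum_recl v)//.
  by move: d0; rewrite !inE => /or4P[| | |/or4P[]] /eqP[-> ->] [][]; lra.
- move=> d0.
  exists (inord (index (u 0, v 0) [:: (0, 0); (1, 0); (0, 1); (1, -1);
                                     (-1, 0); (0, -1); (-1, 1)])) => //.
  exists (bt_sum R (fun k => u k.+1) N, bt_sum R (fun k => v k.+1) N).
    by apply: IH => // k Nk; apply: uv0; exact: leqW.
  rewrite (bt_sum_recl u)// (bt_sum_recl v)// /snow_shift.
  move: d0; rewrite !inE => /or4P[| | |/or4P[]] /eqP[-> ->].
  all: by rewrite inordK //=; congr pair; rewrite /=; lra.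
Qed.

Lemma l1Z3_eventually0 (x : l1Z3) :
  exists N, forall k, (N <= k)%N -> x k = 0.
Proof.
have /finite_seqP[s xs] := l1_finite x.
exists (\max_(i <- s) i).+1 => k; apply: contraTeq => xk.
have ks : k \in s by have : [set` s] k by rewrite -xs.
by rewrite -ltnNge ltnS; exact: leq_bigmax_seq.
Qed.

(** The partial sums are constant from [N] on. *)
Lemma lim_bt_sum (R : realType) (u : nat -> int) (N : nat) :
  (forall k, (N <= k)%N -> u k = 0) ->
  limn (series (fun k : nat => (u k)%:~R / 3 ^+ k.+1 : R)) = bt_sum R u N.
Proof.
move=> u0; apply: lim_near_cst; first exact: Rhausdorff.
exists N => // n /= Nn.
rewrite /series /= (big_cat_nat (leq0n N) Nn)//= big_mkord -[RHS]addr0; congr (_ + _).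
by rewrite big_nat big1// => k /andP[Nk _]; rewrite u0// mul0r.
Qed.

Theorem theorem3p4 (R : realType) (x y : l1Z3) :
  limn (series (fun k : nat => ((x + y) k)%:~R / k.+2%:R : R)) =
    limn (series (fun k : nat => (x k)%:~R / k.+2%:R : R)) +
    limn (series (fun k : nat => (y k)%:~R / k.+2%:R : R)) ->
  zvec x y = 0 ->
  snowflake (limn (series (fun k : nat => (x k)%:~R / 3 ^+ k.+1 : R)),
             limn (series (fun k : nat => (y k)%:~R / 3 ^+ k.+1 : R))).
Proof.
move=> _ zxy n _.
have [M x0] := l1Z3_eventually0 x; have [N y0] := l1Z3_eventually0 y.
have x0' k : (maxn M N <= k)%N -> x k = 0 by rewrite geq_max => /andP[/x0].
have y0' k : (maxn M N <= k)%N -> y k = 0 by rewrite geq_max => /andP[_ /y0].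
rewrite (lim_bt_sum R _ _ x0') (lim_bt_sum R _ _ y0').
apply: snow_bt_sum => [||k|k Nk]; try exact: l1_digit.
  by rewrite -[LHS]/(zvec x y k) zxy.
by rewrite x0' ?y0'.
Qed.
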